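(* Let $\tau\in(0,1)$. If $A_1$ and $A_2$ are nonempty $C$-coconvex sets, then $$V_n\big((1-\tau)\diamond A_1\oplus_0\tau\diamond A_2\big)\le V_n(A_1)^{1-\tau}\,V_n(A_2)^{\tau}.$$
   Context: $C\subset\mathbb{R}^n$ is a fixed pointed closed convex cone with vertex at the origin $o$ and nonempty interior (closed, convex, $\lambda x\in C$ for $x\in C$, $\lambda\ge 0$, and $C\cap(-C)=\{o\}$). Its polar cone is $C^\circ=\{x\in\mathbb{R}^n: x\cdot y\le 0\ \text{for all } y\in C\}$, and $\Omega_C=S^{n-1}\cap\mathrm{int}\,C^\circ$. $V_n$ is volume (Lebesgue measure). For $u\in S^{n-1}$, $t\in\mathbb{R}$, $H^-(u,t)=\{x\in\mathbb{R}^n: x\cdot u\le t\}$. A set $A\subset C$ is $C$-coconvex if $V_n(A)<\infty$ and $A^\bullet=C\setminus A$ is closed and convex. The support function of a $C$-coconvex set $A$ is $\overline h(A,x)=-\sup\{x\cdot y: y\in A^\bullet\}$ for $x\in\mathrm{int}\,C^\circ$; it is positive and finite when $A\ne\emptyset$. The log-co-sum of nonempty $C$-coconvex sets $A_1,A_2$ with respect to $\tau\in(0,1)$ is $$(1-\tau)\diamond A_1\oplus_0\tau\diamond A_2=C\setminus\Big(C\cap\bigcap_{u\in\Omega_C}H^-\big(u,-\overline h(A_1,u)^{1-\tau}\,\overline h(A_2,u)^{\tau}\big)\Big).$$ *)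

(* Defs.v *)
From HB Require Import structures.
From mathcomp Require Import all_boot all_order all_algebra.
From mathcomp Require Import all_classical all_reals all_analysis.
Import Order.TTheory GRing.Theory Num.Theory.
Import numFieldNormedType.Exports.

Set Implicit Arguments.
Unset Strict Implicit.
Unset Printing Implicit Defensive.

Local Open Scope classical_set_scope.
Local Open Scope ring_scope.

Section volume.
Variable R : realType.

Definition tuple_cons n (z : n.-tuple (measurableTypeR R) * measurableTypeR R) :
  n.+1.-tuple (measurableTypeR R) := [tuple of z.2 :: z.1].

Lemma measurable_tuple_cons n : measurable_fun [set: _] (@tuple_cons n).
Proof. exact: measurable_cons. Qed.

Definition lebesgue_cons n
    (mu : {measure set (n.-tuple (measurableTypeR R)) -> \bar R}) :
    set (n.+1.-tuple (measurableTypeR R)) -> \bar R :=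
  pushforward (product_measure1 mu lebesgue_measure) (@tuple_cons n).

HB.instance Definition _ n mu := Measure.copy (@lebesgue_cons n mu)
  (measure_function_pushforward__canonical__measure_function_Measure
    (product_measure1 mu (@lebesgue_measure R)) (@measurable_tuple_cons n)).

Fixpoint lebesgue_tuple n :
    {measure set (n.-tuple (measurableTypeR R)) -> \bar R} :=
  if n is m.+1 then lebesgue_cons (lebesgue_tuple m)
  else dirac ([tuple] : 0.-tuple (measurableTypeR R)).

Definition row_of_tuple n (t : n.-tuple (measurableTypeR R)) : 'rV[R]_n :=
  \row_i tnth t i.

(* Meaningful on Borel sets only: coconvex sets and log-co-sums are differences
   of two closed sets, hence Borel. *)
Definition volume n (A : set 'rV[R]_n) : \bar R :=
  lebesgue_tuple n (@row_of_tuple n @^-1` A).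

Lemma volume_box n (B : 'I_n -> set (measurableTypeR R)) :
  (forall i, measurable (B i)) ->
  volume [set x : 'rV[R]_n | forall i, B i (x ord0 i)] =
  (\prod_(i < n) lebesgue_measure (B i))%E.
Proof.
move=> mB; rewrite /volume.
have preE m (D : 'I_m -> set (measurableTypeR R)) :
    @row_of_tuple m @^-1` [set x : 'rV[R]_m | forall i, D i (x ord0 i)] =
    [set t : m.-tuple (measurableTypeR R) | forall i, D i (tnth t i)].
  apply/seteqP; split => t /= Dt i; have := Dt i; by rewrite mxE.
rewrite preE; elim: n B mB => [|n IH] B mB /=.
  rewrite big_ord0 diracE mem_set//= => -[]//.
rewrite big_ord_recl muleC -(IH (fun i => B (lift ord0 i)))//.
rewrite /lebesgue_cons /pushforward -product_measure1E//; last first.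
  rewrite [X in measurable X](_ : _ = \bigcap_(i in [set: 'I_n])
    ((@tnth n _)^~ i @^-1` B (lift ord0 i))); last first.
    by apply/seteqP; split => t /= h; [move=> i _; exact: h|move=> i; exact: h].
  apply: fin_bigcap_measurable => // i _; rewrite -[X in measurable X]setTI.
  exact: measurable_tnth.
congr (product_measure1 _ _ _); apply/seteqP; split => -[t x] /=.
  move=> h; split; first by move=> i; have := h (lift ord0 i); rewrite tnthS.
  by have := h ord0; rewrite tnth0.
move=> -[ht hx] i; case: (unliftP ord0 i) => [j ->|->].
  by rewrite tnthS; exact: ht.
by rewrite tnth0.
Qed.

End volume.

Section coconvex.
Variables (R : realType) (n : nat).
Implicit Types (C A : set 'rV[R]_n) (u x y : 'rV[R]_n).

Definition dotp x y : R := \sum_(i < n) x ord0 i * y ord0 i.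

Definition pointed_closed_convex_cone C :=
  [/\ closed C, convex_set C,
      (forall x l, C x -> 0 <= l -> C (l *: x)),
      C `&` [set - x | x in C] = [set 0] &
      interior C !=set0].

Definition polar_cone C : set 'rV[R]_n :=
  [set x | forall y, C y -> dotp x y <= 0].

(* The library norm on 'rV[R]_n is the maximum norm, whence the explicit
   Euclidean one. *)
Definition unit_sphere : set 'rV[R]_n := [set u | Num.sqrt (dotp u u) = 1].

Definition Omega C : set 'rV[R]_n := unit_sphere `&` interior (polar_cone C).

Definition halfspace u (t : R) : set 'rV[R]_n := [set x | dotp x u <= t].

Definition coconvex C A :=
  [/\ A `<=` C, (volume A < +oo)%E, closed (C `\` A) & convex_set (C `\` A)].

(* For x in the interior of polar_cone C the supremum is over a set bounded
   above by 0, and nonempty as soon as A != C. *)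
Definition cosupport C A x : R := - sup [set dotp x y | y in C `\` A].

Definition log_cosum C (tau : R) A1 A2 : set 'rV[R]_n :=
  C `\` (C `&` \bigcap_(u in Omega C)
    halfspace u
      (- (cosupport C A1 u `^ (1 - tau) * cosupport C A2 u `^ tau))).

End coconvex.

(* Main.v *)
(** Let [rho A v] be the least [r >= 0] with [r v] in the complement [C \ A].
    For [u] in [Omega C] the definition of the support function gives
    [cosupport A u <= - rho A v * (v . u)]; both sides enter the log-co-sum [L]
    multiplicatively, so [rho L <= rho A1 ^ (1 - tau) * rho A2 ^ tau] on every
    ray.  Since the volume is the integral of [rho ^ n / n] over directions, the
    inequality reduces to Hoelder's; no Brunn-Minkowski theorem is involved.

    Directions are the points [(1, w)] of an affine hyperplane: the integral
    formula is then Tonelli's theorem plus the homogeneity of Lebesgue measure in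
    dimension [n - 1].  Hoelder's inequality appears as the AM-GM inequality
    [rho L ^ n <= (1 - tau) a (rho A1) ^ n + tau b (rho A2) ^ n], valid whenever
    [a ^ (1 - tau) * b ^ tau = 1] and trivial where some [rho] is infinite,
    integrated first and optimised over [a], [b] afterwards. *)
Require Import Defs.
From HB Require Import structures.
From mathcomp Require Import all_boot all_order all_algebra.
From mathcomp Require Import all_classical all_reals all_analysis.
From mathcomp Require Import measurable_realfun ring.
Import Order.TTheory GRing.Theory Num.Theory.
Import numFieldNormedType.Exports.
Set Implicit Arguments.
Unset Strict Implicit.
Unset Printing Implicit Defensive.
Local Open Scope classical_set_scope.
Local Open Scope ring_scope.

(** * Scaling of Lebesgue measure on the line *)

Lemma lebesgue_measure_scale (R : realType) (c : R) (B : set (measurableTypeR R)) :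
  c != 0 -> measurable B ->
  lebesgue_measure B = (`|c|%:E * lebesgue_measure (( *%R c) @^-1` B))%E.
Proof.
move=> c0 mB.
have mc : measurable_fun [set: measurableTypeR R]
    ( *%R c : measurableTypeR R -> measurableTypeR R).
  exact: mulrl_measurable.
pose pf := measure_function_pushforward__canonical__measure_function_Measure
   (@lebesgue_measure R) mc.
(* Lebesgue measure is determined by its values on the intervals []a, b]]. For [c < 0] the preimage
   is [[b / c, a / c[]: the closed end changes side, the length does not notice. *)
apply: (@lebesgue_measure_unique R (mscale `|c|%:nng pf)) => // X [[a b] _ <-].
rewrite /= /mscale /= /pushforward.
have [cgt0|] := ltP 0 c.
  rewrite (_ : _ @^-1` _ = `]a / c, b / c]%classic); last first.
    apply/seteqP; split => x /=; rewrite !in_itv/= ltr_pdivrMr// ler_pdivlMr//;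
      by rewrite (mulrC x).
  rewrite !lebesgue_measure_itv/= !lte_fin ltr_pM2r ?invr_gt0//.
  case: ifPn => _; last by rewrite mule0.
  by rewrite -!EFinB -EFinM gtr0_norm// -mulrBl mulrCA divff ?mulr1.
rewrite le_eqVlt (negbTE c0)/= => clt0.
rewrite (_ : _ @^-1` _ = `[b / c, a / c[%classic); last first.
  apply/seteqP; split => x /=; rewrite !in_itv/= ler_ndivrMr// ltr_ndivlMr//;
    by rewrite (mulrC x) andbC.
rewrite !lebesgue_measure_itv/= !lte_fin ltr_nM2r ?invr_lt0//.
case: ifPn => _; last by rewrite mule0.
by rewrite -!EFinB -EFinM ltr0_norm// -mulrBl mulrCA mulNr divff// mulrN1 opprB.
Qed.

(** * Lebesgue measure along rays *)

Section lebesgue_tuple_theory.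
Variable R : realType.
Local Notation tupleR n := (n.-tuple (measurableTypeR R)).
Local Notation leb := (@lebesgue_measure R).

(** A name of its own for [lebesgue_tuple], to which the sigma-finite structure required by
    Tonelli's theorem can be attached. *)
Definition tuple_measure n : set (tupleR n) -> \bar R := @lebesgue_tuple R n.

HB.instance Definition _ n :=
  Measure.copy (@tuple_measure n) (@lebesgue_tuple R n).

Lemma tuple_measure_sigma_finite n : sigma_finite setT (@tuple_measure n).
Proof.
(* Exhaustion by the cubes [[-k, k]^n], of finite measure by [volume_box]. *)
pose F k := @row_of_tuple R n @^-1`
  [set x : 'rV[R]_n | forall i, `[- k%:R, k%:R]%classic (x ord0 i)].
exists F.
  apply/seteqP; split => // t _.
  exists (\max_(i < n) (Num.truncn `|tnth t i|).+1)%N => //= i.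
  rewrite /= mxE in_itv/= -ler_norml.
  apply: le_trans (ltW (truncnS_gt _)) _; rewrite ler_nat.
  exact: (leq_bigmax i).
move=> k; split.
  rewrite [X in measurable X](_ : _ = \bigcap_(i in [set: 'I_n])
    ((@tnth n _)^~ i @^-1` `[- k%:R, k%:R]%classic)); last first.
    apply/seteqP; split => t /= h i; first by have := h i; rewrite mxE.
    by rewrite mxE; exact: h.
  apply: fin_bigcap_measurable => // i _; rewrite -[X in measurable X]setTI.
  exact: measurable_tnth.
have := @volume_box R n (fun=> `[- k%:R, k%:R]%classic) (fun=> measurable_itv _).
rewrite /volume -/(F k) /tuple_measure => ->.
under eq_bigr do rewrite lebesgue_measure_itv/=.
rewrite ltey_eq; apply/orP; left.
apply: (big_ind (fun x => x \is a fin_num)) => // [x y|i _].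
  exact: fin_numM.
by case: ifPn.
Qed.

HB.instance Definition _ n :=
  Measure_isSigmaFinite.Build _ _ _ (@tuple_measure n)
    (@tuple_measure_sigma_finite n).

Lemma tuple_measureS n (B : set (tupleR n.+1)) :
  tuple_measure B =
  (\int[@tuple_measure n]_t leb [set x | B (tuple_cons (t, x))])%E.
Proof.
rewrite {1}/tuple_measure /= /lebesgue_cons /pushforward /product_measure1.
apply: eq_integral => t _ /=; congr (leb _).
by apply/seteqP; split => x; rewrite /xsection/= ?inE.
Qed.

Definition scale_tuple n (c : R) (t : tupleR n) : tupleR n :=
  [tuple c * tnth t i | i < n].

Lemma measurable_scale_tuple n (c : R) : measurable_fun setT (@scale_tuple n c).
Proof.
apply/measurable_fun_tnthP => i.
rewrite (_ : _ \o _ = ( *%R c) \o (@tnth n _)^~ i); last first.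
  by apply/funext => t /=; rewrite tnth_mktuple.
apply: (@measurableT_comp _ _ _ _ _ _ ( *%R c : measurableTypeR R -> measurableTypeR R)).
  exact: mulrl_measurable.
exact: measurable_tnth.
Qed.

Lemma scale_tuple_cons n (c : R) t x :
  scale_tuple c (tuple_cons (t, x)) = @tuple_cons R n (scale_tuple c t, c * x).
Proof.
apply: eq_from_tnth => i; rewrite tnth_mktuple.
case: (unliftP ord0 i) => [j ->|->]; last by rewrite !tnth0.
by rewrite !tnthS tnth_mktuple.
Qed.

Lemma row_of_scale_tuple n c (t : tupleR n) :
  row_of_tuple (scale_tuple c t) = c *: row_of_tuple t.
Proof. by apply/rowP => i; rewrite !mxE tnth_mktuple. Qed.

Lemma measurable_slice n (B : set (tupleR n.+1)) : measurable B ->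
  measurable_fun setT (fun t => leb [set x | B (tuple_cons (t, x))]).
Proof.
move=> mB; have mB' : measurable (@tuple_cons R n @^-1` B).
  by rewrite -[X in measurable X]setTI; exact: measurable_tuple_cons.
rewrite (_ : (fun _ => _) = leb \o xsection (@tuple_cons R n @^-1` B)).
  exact: measurable_fun_xsection.
apply/funext => t /=; congr (leb _).
by apply/seteqP; split => x; rewrite /xsection/= ?inE.
Qed.

Lemma measurable_slice1 n (B : set (tupleR n.+1)) t : measurable B ->
  measurable ([set x | B (tuple_cons (t, x))] : set (measurableTypeR R)).
Proof.
move=> mB; have mB' : measurable (@tuple_cons R n @^-1` B).
  by rewrite -[X in measurable X]setTI; exact: measurable_tuple_cons.
have := measurable_xsection t mB'; congr measurable.
by apply/seteqP; split => x; rewrite /xsection/= ?inE.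
Qed.

(** Induction on the dimension: the hypothesis replaces the measure on tails by [|c| ^ n] times its
    push-forward under scaling, and the one-dimensional lemma supplies the last factor [|c|] on the
    head coordinate. *)
Lemma tuple_measure_scale n (c : R) (B : set (tupleR n)) : c != 0 -> measurable B ->
  tuple_measure B =
  ((`|c| ^+ n)%:E * tuple_measure (scale_tuple c @^-1` B))%E.
Proof.
move=> c0; elim: n B => [|n IH] B mB.
  rewrite expr0 mul1e; congr tuple_measure.
  by apply/seteqP; split => t /=; rewrite (tuple0 t) (tuple0 (scale_tuple _ _)).
rewrite !tuple_measureS.
pose f t := leb [set x | B (tuple_cons (t, x))].
have mf : measurable_fun setT f by exact: measurable_slice.
pose pf := measure_function_pushforward__canonical__measure_function_Measure
   (@tuple_measure n) (@measurable_scale_tuple n c).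
have cn0 : 0 <= `|c| ^+ n by rewrite exprn_ge0.
rewrite (@eq_measure_integral _ _ _ _ (mscale (NngNum cn0) pf)); last first.
  by move=> D mD _; exact: IH.
rewrite ge0_integral_mscale//.
rewrite ge0_integral_pushforward//; last exact: measurable_scale_tuple.
rewrite preimage_setT exprSr EFinM -muleA; congr (_ * _)%E.
rewrite -ge0_integralZl//; last first.
  apply: (@measurable_slice n (scale_tuple c @^-1` B)).
  by rewrite -[X in measurable X]setTI; exact: measurable_scale_tuple.
apply: eq_integral => t _ /=; rewrite /f (@lebesgue_measure_scale _ c)//.
  congr (_ * leb _)%E; apply/seteqP; split => x /=; by rewrite scale_tuple_cons.
exact: measurable_slice1.
Qed.

(** The mass of [S] for the density [|x| ^ m], which is the Jacobian of [(w, x) |-> x (1, w)] when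
    [w] has [m] coordinates. *)
Definition powmass m (S : set R) : \bar R :=
  (\int[leb]_x (`|x| ^+ m * \1_S x)%:E)%E.

(** The head coordinate is the one set to 1. The parameter runs over the whole line, so each [w]
    accounts for two opposite rays. *)
Definition line_slice n (A : set (tupleR n.+1)) (w : tupleR n) : set R :=
  [set x | A (scale_tuple x (tuple_cons (w, 1)))].

Lemma measurable_ray n :
  measurable_fun setT (fun z : tupleR n * measurableTypeR R =>
    scale_tuple z.2 (tuple_cons (z.1, 1))).
Proof.
apply/measurable_fun_tnthP => i.
rewrite (_ : _ \o _ = fun z => z.2 * tnth (tuple_cons (z.1, 1)) i); last first.
  by apply/funext => z /=; rewrite tnth_mktuple.
apply: (@measurable_funM _ _ R setT snd (fun z => tnth (tuple_cons (z.1, 1)) i)) => //.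
apply: (@measurableT_comp _ _ _ _ _ _ ((@tnth n.+1 _)^~ i)).
  exact: measurable_tnth.
apply: (@measurableT_comp _ _ _ _ _ _ (@tuple_cons R n)).
  exact: measurable_tuple_cons.
exact: measurable_fun_pair.
Qed.

Lemma measurable_ray_density n (A : set (tupleR n.+1)) : measurable A ->
  measurable_fun setT (fun z : tupleR n * measurableTypeR R =>
    (`|z.2| ^+ n * \1_(line_slice A z.1) z.2)%:E).
Proof.
move=> mA; apply/measurable_EFinP; apply: measurable_funM.
  apply: measurable_funX; exact: (@measurableT_comp _ _ _ _ _ _
    (@Num.norm _ R : measurableTypeR R -> measurableTypeR R)).
rewrite (_ : (fun _ => _) = \1_((fun z : tupleR n * measurableTypeR R =>
    scale_tuple z.2 (tuple_cons (z.1, 1))) @^-1` A)) //.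
apply: measurable_indic; rewrite -[X in measurable X]setTI; exact: measurable_ray.
Qed.

Lemma measurable_ray_mass n (A : set (tupleR n.+1)) : measurable A ->
  measurable_fun setT (fun w => powmass n (line_slice A w)).
Proof.
move=> mA.
apply: (measurable_fun_fubini_tonelli_F (m2 := leb)
  (fun z : tupleR n * measurableTypeR R =>
    (`|z.2| ^+ n * \1_(line_slice A z.1) z.2)%:E)).
  exact: measurable_ray_density.
by move=> z; rewrite lee_fin mulr_ge0// exprn_ge0.
Qed.

(** Cut [A] at head coordinate [x]: the cut is [x] times the set of [w] with [x (1, w)] in [A], so
    its measure carries the factor [|x| ^ n]. Tonelli's theorem then exchanges [x] and [w]. *)
Lemma tuple_measure_rays n (A : set (tupleR n.+1)) : measurable A ->
  tuple_measure A =
  (\int[@tuple_measure n]_w powmass n (line_slice A w))%E.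
Proof.
move=> mA; pose D := @tuple_cons R n @^-1` A.
have mD : measurable D.
  by rewrite -[X in measurable X]setTI; exact: measurable_tuple_cons.
transitivity (\int[leb]_x (@tuple_measure n) (ysection D x))%E.
  rewrite tuple_measureS.
  transitivity (\int[@tuple_measure n]_t leb (xsection D t))%E.
    apply: eq_integral => t _; congr (leb _).
    by apply/seteqP; split => x; rewrite /xsection/= ?inE.
  have := @indic_fubini_tonelli _ _ _ _ _ (@tuple_measure n) leb D mD.
  by rewrite indic_fubini_tonelli_FE// indic_fubini_tonelli_GE.
rewrite [RHS](fubini_tonelli (m1 := @tuple_measure n) (m2 := leb)
  (fun z : tupleR n * measurableTypeR R =>
    (`|z.2| ^+ n * \1_(line_slice A z.1) z.2)%:E))/=; last 2 first.
- exact: measurable_ray_density.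
- by move=> z; rewrite lee_fin mulr_ge0// exprn_ge0.
(* The scaling lemma needs [x != 0]; the single height 0 is a null set and is dropped from both
   integrals. *)
have mT0 : measurable ([set: R] `\ (0 : R)) by exact: measurableD.
rewrite -(@integral_setD1 _ _ 0 setT)//; last first.
  apply: measurable_funTS; exact: measurable_fun_ysection.
rewrite -[RHS](@integral_setD1 _ _ 0 setT)//; last first.
  apply: measurable_funTS.
  apply: (measurable_fun_fubini_tonelli_G (m1 := @tuple_measure n)
    (fun z : tupleR n * measurableTypeR R =>
      (`|z.2| ^+ n * \1_(line_slice A z.1) z.2)%:E)).
    exact: measurable_ray_density.
  by move=> z; rewrite lee_fin mulr_ge0// exprn_ge0.
apply: eq_integral => x; rewrite inE => -[_ /= /eqP x0].
have mDx : measurable (ysection D x) by exact: measurable_ysection.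
rewrite (tuple_measure_scale x0 mDx).
rewrite -[in LHS](setIT (_ @^-1` _)) -integral_indic//; last first.
  by rewrite -[X in measurable X]setTI; exact: measurable_scale_tuple.
rewrite -ge0_integralZl//; last first.
  apply/measurable_EFinP; apply: measurable_indic.
  by rewrite -[X in measurable X]setTI; exact: measurable_scale_tuple.
apply: eq_integral => w _; rewrite EFinM; congr (_ * _%:E)%E.
rewrite !indicE /line_slice; congr (_%:R); congr nat_of_bool.
by apply/idP/idP; rewrite !inE /ysection /D /= inE/= scale_tuple_cons mulr1.
Qed.

Lemma measurable_powmass m (S : set (measurableTypeR R)) : measurable S ->
  measurable_fun setT (fun x : measurableTypeR R => (`|x| ^+ m * \1_S x)%:E).
Proof.
move=> mS; apply/measurable_EFinP; apply: measurable_funM => //.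
by apply: measurable_funX; exact: normr_measurable.

Qed.

Lemma powmass_ge0 m S : (0 <= powmass m S)%E.
Proof. by apply: integral_ge0 => x _; rewrite lee_fin mulr_ge0// exprn_ge0. Qed.

Lemma le_powmass m (S T : set (measurableTypeR R)) :
  measurable S -> measurable T -> S `<=` T ->
  (powmass m S <= powmass m T)%E.
Proof.
move=> mS mT ST; apply: ge0_le_integral => //=.
- exact: measurable_powmass.
- exact: measurable_powmass.
move=> x _; rewrite lee_fin ler_wpM2l ?exprn_ge0//.
by rewrite !indicE ler_nat; have [/set_mem/ST/mem_set ->|] := boolP (x \in S).
Qed.

Lemma powmass_opp m (S : set (measurableTypeR R)) : measurable S ->
  powmass m (-%R @^-1` S) = powmass m S.
Proof.
move=> mS.
have mo : measurable_fun setT (-%R : measurableTypeR R -> measurableTypeR R).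
  exact: oppr_measurable.
pose po := measure_function_pushforward__canonical__measure_function_Measure leb mo.
rewrite /powmass [RHS](@eq_measure_integral _ _ _ setT po); last first.
  move=> B mB _; rewrite [LHS](@lebesgue_measure_scale _ (-1))// ?oppr_eq0//.
  rewrite normrN1 mul1e /po /= /pushforward; congr (leb _).
  by apply/seteqP; split => x /=; rewrite mulN1r.
rewrite ge0_integral_pushforward//.
- by rewrite preimage_setT; apply: eq_integral => x _ /=; rewrite normrN.
- exact: measurable_powmass.
Qed.

Lemma powmass_itv m (r : R) : 0 <= r ->
  powmass m `[0, r[%classic = (r ^+ m.+1 / m.+1%:R)%:E.
Proof.
(* The empty interval is set apart, since the fundamental theorem of calculus is applied on a
   nondegenerate one. *)
rewrite le_eqVlt => /predU1P[<-|r0].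
  rewrite set_itvco0 expr0n mul0r /powmass integral0_eq// => x _.
  by rewrite indic0 mulr0.
transitivity (\int[leb]_(x in `[0%R, r[) (x ^+ m)%:E)%E.
  rewrite [RHS]integral_mkcond; apply: eq_integral => x _.
  rewrite patchE indicE; case: ifPn => [|_]; last by rewrite mulr0.
  by rewrite inE/= in_itv/= => /andP[x0 _]; rewrite ger0_norm// mulr1.
rewrite integral_itv_bndo_bndc; last first.
  by apply/measurable_EFinP; apply: measurable_funX; exact: measurable_id.
rewrite (@continuous_FTC2 _ _ (fun x => x ^+ m.+1 / m.+1%:R))//=.
- by rewrite expr0n/= mul0r sube0.
- by apply: continuous_subspaceT => x; exact: exprn_continuous.
- have c x : {for x, continuous (fun x : R => x ^+ m.+1 / m.+1%:R)}.
    by apply: cvgM; [exact: exprn_continuous|exact: cvg_cst].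
  split; [|exact/cvg_at_right_filter/c|exact/cvg_at_left_filter/c].
  by move=> x _; apply: derivableM => //; exact: exprn_derivable.
- move=> x _; rewrite derive1Mr; last exact: exprn_derivable.
  by rewrite exp_derive1/= [_ *: _]mulrC mulfK// pnatr_eq0.
Qed.

Lemma powmass_itvy m (S : set (measurableTypeR R)) : measurable S ->
  `[0, +oo[%classic `<=` S -> powmass m S = +oo%E.
Proof.
move=> mS S0; apply/eqyP => a a0.
(* The summand 1 gives [1 <= r], hence [r ^+ m.+1 >= r >= a * m.+1%:R], and [[0, r[] already has
   mass at least [a]. *)
pose r := a * m.+1%:R + 1.
have r1 : 1 <= r by rewrite lerDr mulr_ge0// ltW.
have : (powmass m `[0%R, r[%classic <= powmass m S)%E.
  apply: le_powmass => //.
  by apply: subset_trans S0 => x /=; rewrite !in_itv/= => /andP[->].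
apply: le_trans; rewrite powmass_itv ?(le_trans _ r1)// lee_fin.
rewrite ler_pdivlMr ?ltr0n//; apply: (@le_trans _ _ r); first by rewrite lerDl.
by rewrite -{1}(expr1 r) ler_weXn2l.
Qed.

End lebesgue_tuple_theory.

(** * Log-co-sums on a ray *)

Section cosum_geometry.
Variables (R : realType) (n : nat).
Implicit Types (C A : set 'rV[R]_n) (u v x y : 'rV[R]_n).

Lemma dotpC x y : dotp x y = dotp y x.
Proof. by apply: eq_bigr => i _; rewrite mulrC. Qed.

Lemma dotpZl (r : R) x y : dotp (r *: x) y = r * dotp x y.
Proof. by rewrite /dotp mulr_sumr; apply: eq_bigr => i _; rewrite mxE mulrA. Qed.

Lemma closed_halfspace u (t : R) : closed (halfspace u t).
Proof.
apply: (@preimage_closed _ _ (fun x => dotp x u) [set x | x <= t]); last first.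
  exact: closed_le.
have cdotp : continuous (fun x : 'rV[R]_n => dotp x u).
  apply: continuous_big => [|i _ x]; first exact: add_continuous.
  apply: (@continuousM R 'rV[R]_n (fun y => y ord0 i) (fun=> u ord0 i)).
    exact: coord_continuous.
  exact: cst_continuous.
by move=> x _; exact: cdotp.
Qed.

Lemma cosupport_ge0 C A u : polar_cone C u -> 0 <= cosupport C A u.
Proof.
move=> Cu; rewrite oppr_ge0.
(* If [C \ A] is empty, the supremum takes its default value 0. *)
have [->|/set0P S0] := eqVneq [set dotp u y | y in C `\` A] set0.
  by rewrite sup0.
by apply: sup_le_ub => // _ [y [Cy _] <-]; exact: Cu.
Qed.

Lemma cosupport_le C A u y : polar_cone C u -> (C `\` A) y ->
  cosupport C A u <= - dotp u y.
Proof.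
move=> Cu Ay; rewrite lerN2; apply: ub_le_sup; last by exists y.
by exists 0 => _ [z [Cz _] <-]; exact: Cu.
Qed.

Lemma log_cosum_sub C (tau : R) A1 A2 : log_cosum C tau A1 A2 `<=` C.
Proof. by move=> x []. Qed.

Lemma log_cosum_ray C (tau : R) A1 A2 v (r1 r2 r : R) :
  (forall x l, C x -> 0 <= l -> C (l *: x)) ->
  0 < tau -> tau < 1 -> C v -> 0 <= r1 -> 0 <= r2 ->
  (C `\` A1) (r1 *: v) -> (C `\` A2) (r2 *: v) ->
  r1 `^ (1 - tau) * r2 `^ tau <= r ->
  ~ log_cosum C tau A1 A2 (r *: v).
Proof.
move=> coneC tau0 tau1 Cv r10 r20 A1v A2v ler [_]; apply; split.
  by apply: coneC => //; rewrite (le_trans _ ler)// mulr_ge0 ?powR_ge0.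
move=> u [_ /interior_subset Cu]; rewrite /halfspace/= dotpZl lerNr.
(* The common factor of the two support bounds: it comes out of the weighted geometric mean with
   exponent [(1 - tau) + tau = 1], leaving the same inequality for every [u]. *)
pose q := - dotp v u.
have q0 : 0 <= q by rewrite oppr_ge0 dotpC Cu.
have h1 : cosupport C A1 u <= r1 * q.
  by rewrite mulrN -dotpZl dotpC; exact: cosupport_le.
have h2 : cosupport C A2 u <= r2 * q.
  by rewrite mulrN -dotpZl dotpC; exact: cosupport_le.
have tau1' : 0 <= 1 - tau by rewrite subr_ge0 ltW.
apply: (@le_trans _ _ ((r1 * q) `^ (1 - tau) * (r2 * q) `^ tau)).
  apply: ler_pM; rewrite ?powR_ge0// ge0_ler_powR// ?nnegrE ?(ltW tau0)//;
    by rewrite ?cosupport_ge0// mulr_ge0.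
rewrite !powRM// mulrACA -powRD ?subrK ?oner_eq0// powRr1//.
by rewrite -mulrN ler_wpM2r.
Qed.

End cosum_geometry.

(** * Weighted arithmetic and geometric means *)

Section real_lemmas.
Variable R : realType.
Implicit Types (x y tau : R).

Lemma powR_AMGM tau x y : 0 < tau -> tau < 1 -> 0 <= x -> 0 <= y ->
  x `^ (1 - tau) * y `^ tau <= (1 - tau) * x + tau * y.
Proof.
move=> tau0 tau1 x0 y0; have tau1' : 0 < 1 - tau by rewrite subr_gt0.
(* Young's inequality for the conjugate exponents [1 / (1 - tau)] and [1 / tau]. *)
have := @conjugate_powR R (x `^ (1 - tau)) (y `^ tau) (1 - tau)^-1 tau^-1.
rewrite !powR_ge0 !invr_gt0 !invrK subrK -!powRrM.
rewrite !mulfV ?gt_eqF// !powRr1// => /(_ isT isT tau1' tau0 erefl).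
by rewrite (mulrC x) (mulrC y).
Qed.

Lemma closed_inf (S : set R) : closed S -> has_inf S -> S (inf S).
Proof.
move=> clS infS; apply: clS => B /nbhs_ballP[e /= e0 eB].
have [x Sx xe] := inf_adherent e0 infS.
exists x; split => //; apply: eB; rewrite /ball/= distrC ger0_norm.
  by rewrite ltrBlDl.
by rewrite subr_ge0; apply: inf_lbound => //; case: infS.
Qed.

(* Take [a = t `^ tau] and [b = t `^ (tau - 1)] with [t = y / x]; when [x] or
   [y] vanishes, [b] or [a] is made arbitrarily small. *)
Lemma le_powR_mean tau (z x y : R) : 0 < tau -> tau < 1 -> 0 <= x -> 0 <= y ->
  (forall a b, 0 < a -> 0 < b -> a `^ (1 - tau) * b `^ tau = 1 ->
    z <= (1 - tau) * a * x + tau * b * y) ->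
  z <= x `^ (1 - tau) * y `^ tau.
Proof.
move=> tau0 tau1 x0 y0 H; have tau1' : 0 < 1 - tau by rewrite subr_gt0.
have ab t : 0 < t -> (t `^ tau) `^ (1 - tau) * (t `^ (- (1 - tau))) `^ tau = 1.
  by move=> t0; rewrite -!powRrM mulNr (mulrC tau) powRN mulfV// gt_eqF// powR_gt0.
have Hab t : 0 < t ->
    z <= (1 - tau) * t `^ tau * x + tau * t `^ (- (1 - tau)) * y.
  by move=> t0; apply: H; rewrite ?powR_gt0// ab.
have [xE|xN0] := eqVneq x 0.
  rewrite xE powR0 ?gt_eqF// mul0r; apply/ler_addgt0Pr => e e0; rewrite add0r.
  have k0 : 0 < tau * y + 1 by rewrite ltr_wpDl// mulr_ge0// ltW.
  (* Chosen so that [b = t ^ (- (1 - tau))] equals [e / (tau * y + 1)], whence [tau * b * y <= e];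
     the 1 keeps the denominator positive. The case [y = 0] is symmetric. *)
  pose t := (e / (tau * y + 1)) `^ (- (1 - tau)^-1).
  have t0 : 0 < t by rewrite powR_gt0// divr_gt0.
  have := Hab _ t0; rewrite xE mulr0 add0r -powRrM mulrNN mulVf ?gt_eqF//.
  rewrite powRr1; last by rewrite divr_ge0// ltW.
  by move=> /le_trans; apply; rewrite mulrAC mulrCA ger_pMr// ler_pdivrMr// mul1r lerDl.
have [yE|yN0] := eqVneq y 0.
  rewrite yE (@powR0 _ tau) ?gt_eqF// mulr0; apply/ler_addgt0Pr => e e0; rewrite add0r.
  have k0 : 0 < (1 - tau) * x + 1 by rewrite ltr_wpDl// mulr_ge0// ltW.
  pose t := (e / ((1 - tau) * x + 1)) `^ (tau^-1).
  have t0 : 0 < t by rewrite powR_gt0// divr_gt0.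
  have := Hab _ t0; rewrite yE mulr0 addr0 -powRrM mulVf ?gt_eqF//.
  rewrite powRr1; last by rewrite divr_ge0// ltW.
  by move=> /le_trans; apply; rewrite mulrAC mulrCA ger_pMr// ler_pdivrMr// mul1r lerDl.
have {}x0 : 0 < x by rewrite lt0r xN0.
have {}y0 : 0 < y by rewrite lt0r yN0.
have := Hab _ (divr_gt0 y0 x0).
have -> : (1 - tau) * (y / x) `^ tau * x = (1 - tau) * (x `^ (1 - tau) * y `^ tau).
  rewrite powRM ?invr_ge0 ?(ltW x0) ?(ltW y0)// -powR_inv1 ?(ltW x0)// -powRrM mulN1r.
  rewrite -mulrA; congr (_ * _); rewrite -mulrA mulrC; congr (_ * _).
  by rewrite addrC powRD ?xN0 ?implybT// powRr1 ?(ltW x0).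
have -> : tau * (y / x) `^ (- (1 - tau)) * y = tau * (x `^ (1 - tau) * y `^ tau).
  rewrite powRM ?invr_ge0 ?(ltW x0) ?(ltW y0)//.
  rewrite -powR_inv1 ?(ltW x0)// -powRrM mulrNN mul1r.
  rewrite -mulrA; congr (_ * _); rewrite mulrAC mulrC; congr (_ * _).
  rewrite -{2}(powRr1 (ltW y0)) -powRD ?yN0 ?implybT//.
  by congr (_ `^ _); ring.
by rewrite -mulrDl subrK mul1r.
Qed.

End real_lemmas.

(** * Borel sets of row vectors *)

Section borel_rows.
Variables (R : realType) (n : nat).
Implicit Types U A : set 'rV[R]_n.

(** An open set is the union of the open boxes with rational endpoints that it contains, and there
    are countably many such boxes. *)
Lemma measurable_row_open U : open U -> measurable (@row_of_tuple R n @^-1` U).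
Proof.
move=> oU.
pose box (q : {ffun 'I_n -> rat * rat}) : set 'rV[R]_n :=
  [set x | forall i, `]ratr (q i).1, ratr (q i).2[%classic (x ord0 i)].
pose F q := [set t | box q `<=` U /\ box q (@row_of_tuple R n t)].
have -> : @row_of_tuple R n @^-1` U = \bigcup_q F q.
  apply/seteqP; split => [t /= Ut|t [q _ [/[apply]]]//].
  (* Neighbourhoods of a matrix are given entrywise, so a rational interval can be picked for each
     coordinate separately. *)
  have [P Pt PU] : nbhs (row_of_tuple t) U by exact: open_nbhs_nbhs.
  have /choice[q qP] (i : 'I_n) : exists q : rat * rat,
      `]ratr q.1, ratr q.2[%classic (tnth t i) /\
      `]ratr q.1, ratr q.2[%classic `<=` P ord0 i.
    have /nbhs_ballP[e /= e0 eP] := Pt ord0 i.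
    rewrite mxE in eP.
    have [a] := @rat_in_itvoo R (tnth t i - e) (tnth t i) ltac:(by rewrite ltrBlDr ltrDl).
    have [b] := @rat_in_itvoo R (tnth t i) (tnth t i + e) ltac:(by rewrite ltrDl).
    rewrite !in_itv/= => /andP[tb be] /andP[ea at_].
    exists (a, b); split => [|x]/=; rewrite in_itv/= ?at_ ?tb// => /andP[ax xb].
    apply: eP; rewrite /ball/= ltr_distlC.
    by rewrite (lt_trans ea ax) (lt_trans xb be).
  exists [ffun i => q i] => //; split.
    move=> x xq; apply: PU => i j; rewrite (ord1 i).
    by have [_] := qP j; apply; have := xq j; rewrite ffunE.
  by move=> i; rewrite mxE ffunE; have [] := qP i.
apply: countable_bigcupT_measurable => // q.
have [qU|qU] := pselect (box q `<=` U); last first.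
  by rewrite [X in measurable X](_ : _ = set0)//; apply/seteqP; split => // t [].
rewrite [X in measurable X](_ : _ = \bigcap_(i in [set: 'I_n])
    ((@tnth n _)^~ i @^-1` `]ratr (q i).1, ratr (q i).2[%classic)); last first.
  apply/seteqP; split => [t [_ h] i _|t h]/=; first by have := h i; rewrite mxE.
  by split => // i; rewrite mxE; exact: h.
apply: fin_bigcap_measurable => // i _; rewrite -[X in measurable X]setTI.
exact: measurable_tnth.
Qed.

Lemma measurable_row_closed A : closed A -> measurable (@row_of_tuple R n @^-1` A).
Proof.
move=> cA; rewrite -(setCK A) preimage_setC; apply: measurableC.
by apply: (@measurable_row_open (~` A)); exact: closed_openC.
Qed.

(** [A] is recovered as [C \ (C \ A)], a difference of closed sets; this covers both coconvex sets
    and log-co-sums. *)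
Lemma measurable_row_setD (C A : set 'rV[R]_n) : A `<=` C ->
  closed C -> closed (C `\` A) -> measurable (@row_of_tuple R n @^-1` A).
Proof.
move=> sAC closedC closedCA; rewrite -((setIidPr C A).2 sAC) -setDD.
exact: (measurableD (measurable_row_closed closedC) (measurable_row_closed closedCA)).
Qed.

End borel_rows.

(** * The inequality along a single line *)

Section ray_comparison.
Variables (R : realType) (n m : nat).
Variables (C A1 A2 : set 'rV[R]_n) (tau a b : R).
Hypotheses (cone_C : pointed_closed_convex_cone C).
Hypotheses (tau0 : 0 < tau) (tau1 : tau < 1).
Hypotheses (a0 : 0 < a) (b0 : 0 < b) (ab1 : a `^ (1 - tau) * b `^ tau = 1).
Hypotheses (cA1 : closed (C `\` A1)) (cA2 : closed (C `\` A2)).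

Let L := log_cosum C tau A1 A2.
Let S (A : set 'rV[R]_n) v : set (measurableTypeR R) := [set r | A (r *: v)].

Let coneZ x l : C x -> 0 <= l -> C (l *: x).
Proof. by case: cone_C => _ _ h _ _; exact: h. Qed.

(** The least parameter exists because [C \ A] is closed; below it the ray stays in the cone but
    outside [C \ A], hence in [A]. This bounds the slices of [A1] and [A2] from below, as the larger
    side of the inequality requires. *)
Lemma radial_min A v : closed (C `\` A) ->
  (exists2 r, 0 <= r & (C `\` A) (r *: v)) -> C v ->
  exists2 r, 0 <= r & (C `\` A) (r *: v) /\ `[0, r[%classic `<=` S A v.
Proof.
move=> cA [r0 r00 Ar0] Cv.
pose T := [set r : R | 0 <= r] `&` [set r | (C `\` A) (r *: v)].
have lbT : lbound T 0 by move=> r [].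
have infT : has_inf T by split; [exists r0|exists 0].
have clT : closed T.
  apply: closedI; first exact: closed_ge.
  apply: (@preimage_closed _ _ (fun r : R => r *: v)) => // r _.
  exact: scalel_continuous.
have [rho0 Arho] : T (inf T) by exact: closed_inf.
exists (inf T) => //; split => // r /=; rewrite in_itv/= => /andP[r1 rlt].
apply: contrapT => nAr; move: rlt; apply/negP; rewrite -leNgt.
by apply: inf_lbound; [case: infT|split=> //; split=> //; exact: coneZ].
Qed.

Lemma ray_mass_le_cone v : C v -> v != 0 ->
  (forall A, [\/ A = A1, A = A2 | A = L] -> measurable (S A v)) ->
  (powmass m (S L v) <= ((1 - tau) * a)%:E * powmass m (S A1 v) +
                        (tau * b)%:E * powmass m (S A2 v))%E.
Proof.
move=> Cv v0 mS.
have mS1 : measurable (S A1 v) by apply: mS; apply: Or31.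
have mS2 : measurable (S A2 v) by apply: mS; apply: Or32.
have mSL : measurable (S L v) by apply: mS; apply: Or33.
have ca0 : 0 < (1 - tau) * a by rewrite mulr_gt0// subr_gt0.
have cb0 : 0 < tau * b by rewrite mulr_gt0.
(* A ray that never meets [C \ A] lies entirely in [A], so its mass is infinite and the bound is
   trivial. *)
have massy A : measurable (S A v) -> 
    ~ (exists2 r, 0 <= r & (C `\` A) (r *: v)) -> powmass m (S A v) = +oo%E.
  move=> mA nA; apply: powmass_itvy => // r /=; rewrite in_itv/= andbT => r0.
  by apply: contrapT => nAr; apply: nA; exists r => //; split => //; exact: coneZ.
have [/(radial_min cA1)/(_ Cv)[r1 r10 [Ar1 S1]]|/massy ->//] :=
    pselect (exists2 r, 0 <= r & (C `\` A1) (r *: v)); last first.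
  rewrite gt0_muley ?lte_fin// addye ?leey// gt_eqF// (lt_le_trans (ltNyr 0))//.
  by rewrite mule_ge0 ?powmass_ge0 ?lee_fin ?ltW.
have [/(radial_min cA2)/(_ Cv)[r2 r20 [Ar2 S2]]|/massy ->//] :=
    pselect (exists2 r, 0 <= r & (C `\` A2) (r *: v)); last first.
  rewrite gt0_muley ?lte_fin// addey ?leey// gt_eqF// (lt_le_trans (ltNyr 0))//.
  by rewrite mule_ge0 ?powmass_ge0 ?lee_fin ?ltW.
pose r := r1 `^ (1 - tau) * r2 `^ tau.
have r0 : 0 <= r by rewrite mulr_ge0 ?powR_ge0.
(* Pointedness of [C] excludes negative parameters; [log_cosum_ray] excludes those at least [r]. *)
have SL : S L v `<=` `[0, r[%classic.
  move=> x Lx; rewrite /= in_itv/=.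
  apply/andP; split; rewrite leNgt || rewrite ltNge; apply/negP.
    move=> x0; have Cx := log_cosum_sub Lx.
    case: cone_C => _ _ _ CN _.
    have : (C `&` [set - x | x in C]) (x *: v).
      split => //; exists ((- x) *: v); last by rewrite scaleNr opprK.
      by apply: coneZ => //; rewrite oppr_ge0 ltW.
    by rewrite CN => /eqP; rewrite scaler_eq0 (lt_eqF x0) (negbTE v0).
  move=> rx; apply: (log_cosum_ray coneZ tau0 tau1 Cv r10 r20 Ar1 Ar2 rx).
  exact: Lx.
apply: (@le_trans _ _ (r ^+ m.+1 / m.+1%:R)%:E).
  by rewrite -powmass_itv//; apply: le_powmass.
apply: (@le_trans _ _ (((1 - tau) * a)%:E * powmass m `[0%R, r1[%classic
   + (tau * b)%:E * powmass m `[0%R, r2[%classic)%E).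
  rewrite !powmass_itv// -!EFinM -EFinD lee_fin.
  rewrite !mulrA -mulrDl ler_pM2r ?invr_gt0 ?ltr0n//.
  (* The weights [a] and [b] disappear from the geometric mean by [ab1], which leaves exactly
     [r ^+ m.+1]. *)
  have := @powR_AMGM R tau (a * r1 ^+ m.+1) (b * r2 ^+ m.+1) tau0 tau1.
  rewrite !mulr_ge0 ?exprn_ge0 ?(ltW a0) ?(ltW b0)// => /(_ isT isT).
  rewrite !powRM ?exprn_ge0 ?(ltW a0) ?(ltW b0)// mulrACA ab1 mul1r !mulrA.
  apply: le_trans; rewrite /r -!powR_mulrn ?mulr_ge0 ?powR_ge0//.
  by rewrite powRM ?powR_ge0// (powRAC r1) (powRAC r2).
by apply: leeD; rewrite lee_pmul2l ?lte_fin//; apply: le_powmass.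
Qed.

(** With the first coordinate fixed to 1, the cone may lie on the side of [v], of [- v], or of
    neither. The second case reduces to the first as the density is even; in the third the slice of
    the log-co-sum lies in [{0}] and has no mass. *)
Lemma ray_mass_le v : v != 0 ->
  (forall A w, [\/ A = A1, A = A2 | A = L] -> measurable (S A w)) ->
  (powmass m (S L v) <= ((1 - tau) * a)%:E * powmass m (S A1 v) +
                        (tau * b)%:E * powmass m (S A2 v))%E.
Proof.
move=> v0 mS; have [Cv|nCv] := pselect (C v).
  by apply: ray_mass_le_cone => // A /mS.
have [CNv|nCNv] := pselect (C (- v)).
  have SN A : S A v = -%R @^-1` (S A (- v)).
    by apply/seteqP; split => r /=; rewrite /S/= scaleNr scalerN opprK.
  rewrite !SN !powmass_opp; [|by apply: mS; constructor..].
  by apply: ray_mass_le_cone => //; rewrite ?oppr_eq0// => A /mS.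
suff -> : powmass m (S L v) = 0%E.
  by rewrite adde_ge0// mule_ge0 ?powmass_ge0// lee_fin ltW// mulr_gt0// subr_gt0.
apply/eqP; rewrite eq_le powmass_ge0 andbT.
apply: (@le_trans _ _ (powmass m [set 0])); last first.
  rewrite /powmass (_ : (fun x => _) = (fun x => (`|x| ^+ m)%:E) \_ [set (0 : R)]).
    by rewrite -integral_mkcond integral_set1.
  by apply/funext => x; rewrite patchE indicE; case: ifPn; rewrite (mulr1, mulr0).
apply: le_powmass => //; first by apply: mS; constructor.
move=> x /log_cosum_sub Cx; apply/eqP; apply: contrapT => /negP.
rewrite neq_lt => /orP[x0|x0].
  apply: nCNv; have := coneZ Cx (_ : 0 <= - x^-1).
  rewrite scalerA mulNr mulVf ?lt_eqF// scaleN1r; apply.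
  by rewrite oppr_ge0 invr_le0 ltW.
apply: nCv; have := coneZ Cx (_ : 0 <= x^-1).
by rewrite scalerA mulVf ?gt_eqF// scale1r; apply; rewrite invr_ge0 ltW.
Qed.

End ray_comparison.

(** * Integration over directions and choice of the weights *)

Lemma closed_setD_log_cosum (R : realType) n (C A1 A2 : set 'rV[R]_n) (tau : R) :
  closed C -> closed (C `\` log_cosum C tau A1 A2).
Proof.
move=> closedC; rewrite /log_cosum setDD; apply: closedI => //.
apply: closedI => //; apply: closed_bigI => u _; exact: closed_halfspace.
Qed.

(** In dimension 0 the only vector has norm 0, so there are no unit vectors and the intersection of
    half-spaces is over an empty family. The ray formula starts at dimension 1. *)
Lemma log_cosum_dim0 (R : realType) (C A1 A2 : set 'rV[R]_0) (tau : R) :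
  log_cosum C tau A1 A2 = set0.
Proof.
apply/seteqP; split => // x [Cx]; apply; split => // u [].
by rewrite /unit_sphere/= /dotp big_ord0 sqrtr0 => /eqP; rewrite eq_sym oner_eq0.
Qed.

Lemma line_slice_row (R : realType) n (A : set 'rV[R]_n.+1) w :
  line_slice (@row_of_tuple R n.+1 @^-1` A) w =
  [set r | A (r *: row_of_tuple (tuple_cons (w, 1)))].
Proof.
by apply/seteqP; split => r; rewrite /line_slice/= row_of_scale_tuple.
Qed.

(** Integrates [ray_mass_le] over all [w]. The right side is linear in the two volumes, so it passes
    through the integral for each fixed pair of weights. *)
Lemma volume_log_cosum_le (R : realType) n (C A1 A2 : set 'rV[R]_n.+1)
    (tau a b : R) :
  pointed_closed_convex_cone C -> 0 < tau -> tau < 1 ->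
  coconvex C A1 -> coconvex C A2 ->
  0 < a -> 0 < b -> a `^ (1 - tau) * b `^ tau = 1 ->
  (volume (log_cosum C tau A1 A2) <=
   ((1 - tau) * a)%:E * volume A1 + (tau * b)%:E * volume A2)%E.
Proof.
move=> cone_C tau0 tau1 [sA1 _ clA1 _] [sA2 _ clA2 _] a0 b0 ab1.
have clC : closed C by case: cone_C.
have mA A : [\/ A = A1, A = A2 | A = log_cosum C tau A1 A2] ->
    measurable (@row_of_tuple R n.+1 @^-1` A).
  move=> [->|->|->]; apply: (measurable_row_setD _ clC) => //.
    exact: log_cosum_sub.
  exact: closed_setD_log_cosum.
have mA1 := mA _ (Or31 _ _ erefl); have mA2 := mA _ (Or32 _ _ erefl).
have mL := mA _ (Or33 _ _ erefl).
have ca0 : 0 < (1 - tau) * a by rewrite mulr_gt0// subr_gt0.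
have cb0 : 0 < tau * b by rewrite mulr_gt0.
have fL := measurable_ray_mass mL.
have f1 := measurable_ray_mass mA1; have f2 := measurable_ray_mass mA2.
rewrite /volume -!/(tuple_measure _) !tuple_measure_rays//.
rewrite -!ge0_integralZl//; [|by rewrite ?lee_fin ?ltW// => *; exact: powmass_ge0..].
rewrite -ge0_integralD//; last 4 first.
- by move=> w _; rewrite mule_ge0 ?powmass_ge0// lee_fin ltW.
- exact: measurable_funeM.
- by move=> w _; rewrite mule_ge0 ?powmass_ge0// lee_fin ltW.
- exact: measurable_funeM.
apply: ge0_le_integral => //=.
- by move=> w _; exact: powmass_ge0.
- by apply: emeasurable_funD; exact: measurable_funeM.
move=> w _; rewrite !line_slice_row; apply: ray_mass_le => //.
  apply/eqP => /rowP/(_ ord0); rewrite !mxE tnth0 => /eqP; exact/negP/oner_neq0.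
move=> A v /mA mrA.
(* Measurability along the line spanned by [v] is pulled back from the Borel set through
   [r |-> r v]. *)
pose scale_v (r : measurableTypeR R) := [tuple r * v ord0 i | i < n.+1].
have mscale : measurable_fun setT (scale_v : _ -> n.+1.-tuple (measurableTypeR R)).
  apply/measurable_fun_tnthP => i.
  rewrite (_ : _ \o _ = fun r => r * v ord0 i); first exact: mulrr_measurable.
  by apply/funext => r /=; rewrite tnth_mktuple.
have := mscale measurableT _ mrA; rewrite setTI; congr measurable.
apply/seteqP; split => r /=; suff -> : row_of_tuple (scale_v r) = r *: v by [];
  by apply/rowP => i; rewrite !mxE tnth_mktuple.
Qed.

Theorem theorem7p1 (R : realType) (n : nat) (C A1 A2 : set 'rV[R]_n) (tau : R) :
  pointed_closed_convex_cone C ->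
  0 < tau -> tau < 1 ->
  A1 !=set0 -> coconvex C A1 ->
  A2 !=set0 -> coconvex C A2 ->
  (volume (log_cosum C tau A1 A2)
     <= volume A1 `^ (1 - tau) * volume A2 `^ tau)%E.
Proof.
move=> cone_C tau0 tau1 _ cA1 _ cA2; case: n C A1 A2 cone_C cA1 cA2 =>
    [|n] C A1 A2 cone_C cA1 cA2.
  by rewrite log_cosum_dim0 /volume preimage_set0 measure0 mule_ge0 ?poweR_ge0.
have vol_ge0 (A : set 'rV[R]_n.+1) : (0 <= volume A)%E by exact: measure_ge0.
have [_ V1 _ _] := cA1; have [_ V2 _ _] := cA2.
have /fineK V1E : volume A1 \is a fin_num by rewrite ge0_fin_numE.
have /fineK V2E : volume A2 \is a fin_num by rewrite ge0_fin_numE.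
(* The weights [a = b = 1] already show that the volume is finite, so that the optimisation can take
   place in the reals. *)
have VLE : volume (log_cosum C tau A1 A2) \is a fin_num.
  rewrite ge0_fin_numE//; apply: le_lt_trans.
    apply: (@volume_log_cosum_le _ _ _ _ _ _ 1 1 cone_C tau0 tau1 cA1 cA2) => //.
    by rewrite !powR1 mulr1.
  by rewrite -V1E -V2E -!EFinM -EFinD ltry.
rewrite -(fineK VLE) -V1E -V2E !poweR_EFin -EFinM lee_fin.
apply: le_powR_mean; rewrite ?fine_ge0// => a b a0 b0 ab1.
rewrite -lee_fin EFinD !EFinM fineK// V1E V2E.
exact: volume_log_cosum_le.
Qed.
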